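(* Let $A,B,C\in\mathcal{M}_n(\mathbb{C})$ be such that $\{A,B,C\}$ is a commuting set of diagonalizable matrices, and consider the Stein equation $$(E)\qquad AXB-X=C$$ with unknown $X\in\mathcal{M}_n(\mathbb{C})$. Let $\widehat{X}=(AB-I_n)^{\mathbf{D}}C$. The following statements hold. (i) $\widehat{X}$ is a diagonalizable matrix that commutes with all the matrices in the set $\{A,B,C\}$. If $A,B,C$ are normal matrices, then $\widehat{X}=(AB-I_n)^{\dagger}C$ and this is a normal matrix. (ii) Any of the following conditions is a necessary and sufficient condition for the consistency of $(E)$: (a) $\widehat{X}$ is a solution of $(E)$; (b) the standard linear equation $(AB-I_n)X=C$ is consistent; (c) $\widehat{X}$ is a solution of the standard linear equation $(AB-I_n)X=C$. (iii) If $(E)$ is consistent and $(\mathbf{a}=(a_1,\dots,a_n),\mathbf{b}=(b_1,\dots,b_n))$ is a sequence of induced vectors by $(A,B)$, then (a) the dimension of the affine set of solutions of $(E)$ is the cardinality of $\{(r,s)\in\{1,\dots,n\}^2\mid a_rb_s=1\}$; (b) the condition that $a_rb_s\neq 1$ whenever $r\neq s$ is sufficient for all solutions of $(E)$ to be diagonalizable matrices. (iv) If $AB-I_n$ is invertible, then $\widehat{X}=(AB-I_n)^{-1}C$. In addition, if $X\neq\widehat{X}$ is a solution of $(E)$, then $AX\neq XA$ and $BX\neq XB$. (v) If $(E)$ is consistent and $AB-I_n$ is not invertible, then $(E)$ has an infinite number of solutions.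
   Context: $\mathcal{M}_n(\mathbb{C})$ is the set of complex $n\times n$ matrices and $I_n$ the identity matrix. A set of matrices is commuting if any two of its elements commute. An equation is consistent if it has at least one solution. $M$ is normal if $MM^\star=M^\star M$, where $M^\star$ is the conjugate transpose. A pair $(\mathbf{a},\mathbf{b})\in\mathbb{C}^n\times\mathbb{C}^n$ is a sequence of induced vectors by $(A,B)$ if there is an invertible $S\in\mathcal{M}_n(\mathbb{C})$ with $S^{-1}AS=\mathrm{diag}(\mathbf{a})$ and $S^{-1}BS=\mathrm{diag}(\mathbf{b})$. $M^{\dagger}$ denotes the Moore–Penrose inverse. The Drazin inverse $M^{\mathbf{D}}$ of $M\in\mathcal{M}_n(\mathbb{C})$ is the unique matrix with $M^{p+1}M^{\mathbf{D}}=M^{p}$, $M^{\mathbf{D}}MM^{\mathbf{D}}=M^{\mathbf{D}}$, $M^{\mathbf{D}}M=MM^{\mathbf{D}}$, where $p=\mathrm{ind}(M)$ is the least nonnegative integer with $\mathrm{rank}(M^{p+1})=\mathrm{rank}(M^p)$. *)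

(* Defs.v *)
From HB Require Import structures.
From mathcomp Require Import all_boot all_order all_algebra.
From mathcomp Require Import spectral sesquilinear mxred complex.
From mathcomp Require Import boolp classical_sets cardinality reals.

Set Implicit Arguments.
Unset Strict Implicit.
Unset Printing Implicit Defensive.

Import Order.TTheory GRing.Theory Num.Theory.
Local Open Scope ring_scope.
Local Open Scope sesquilinear_scope.

Section DrazinRing.
Context {R : pzRingType}.

Let drazin_ring p (M D : R) :=
  [/\ M ^+ p.+1 * D = M ^+ p, D * M * D = D & D * M = M * D].

Lemma drazin_ring_ex p (M Z W K' : R) :
    let K := M ^+ (p + p.+1) in
    M ^+ p = Z * K -> M ^+ p = K * W -> K * K' * K = K ->
  drazin_ring p M (M ^+ p * K' * M ^+ p).
Proof.
move=> K ZE WE KKK.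
have NK : M ^+ p * K' * K = M ^+ p by rewrite ZE -!mulrA (mulrA K) KKK.
have KN : K * K' * M ^+ p = M ^+ p by rewrite WE mulrA KKK.
have DM : M ^+ p * K' * M ^+ p = Z * M ^+ p.
  by rewrite [X in X * K' * _]ZE -!mulrA (mulrA K) KN.
have DW : M ^+ p * K' * M ^+ p = M ^+ p * W.
  by rewrite [X in _ * K' * X]WE mulrA NK.
split.
- by rewrite !mulrA -exprD addSnnS.
- have {1}-> : M ^+ p * K' * M ^+ p * M * (M ^+ p * K' * M ^+ p)
             = M ^+ p * K' * (M ^+ p * M * M ^+ p) * K' * M ^+ p.
    by rewrite !mulrA.
  by rewrite -exprSr -exprD addSnnS NK.
- rewrite {1}DM DW -mulrA -exprSr mulrA -exprS.
  have -> : M ^+ p.+1 * W = Z * (K * M * W).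
    by rewrite exprSr [X in X * M * W]ZE !mulrA.
  have -> : K * M = M * K by rewrite -exprSr -exprS.
  by rewrite -mulrA -WE -exprS.
Qed.

Lemma drazin_ring_uniq p (M D E : R) :
  drazin_ring p M D -> drazin_ring p M E -> D = E.
Proof.
move=> [D1 D2 D3] [E1 E2 E3].
have pw G : G * M * G = G -> G * M = M * G -> G * M = G ^+ p.+1 * M ^+ p.+1.
  move=> G2 G3; rewrite -exprMn_comm //.
  elim: (p) => [|k IHk]; first by rewrite expr1.
  by rewrite exprS -IHk mulrA G2.
have DE : D * M = D * M * (E * M).
  rewrite {1 2}(pw D) // -mulrA; congr (_ * _).
  by rewrite E3 mulrA -exprSr exprS -mulrA E1 -exprS.
have ED : E * M = D * M * (E * M).
  have -> : E * M = M ^+ p.+1 * E ^+ p.+1.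
    by rewrite (pw E) //; apply: commrX; apply/commr_sym/commrX/commr_sym.
  rewrite mulrA; congr (_ * _).
  have cD : D * M * M ^+ p.+1 = M ^+ p.+1 * (M * D).
    by rewrite -D3; apply: commrX; rewrite /GRing.comm {1}D3 -mulrA.
  by rewrite cD mulrA -exprSr exprS -mulrA D1 -exprS.
have DEM : D * M = E * M by rewrite DE -ED.
by rewrite -[LHS]D2 DEM -mulrA -D3 DEM E3 mulrA E2.
Qed.

End DrazinRing.

Section Drazin.
Context {F : fieldType} {n : nat}.
Implicit Types M D E : 'M[F]_n.

Lemma mxindex_ex M : exists p, \rank (M ^+ p.+1) == \rank (M ^+ p).
Proof.
apply: contrapT => /forallNP noP.
have rk k : (\rank (M ^+ k) + k <= n)%N.
  elim: k => [|k IHk]; first by rewrite addn0 rank_leq_row.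
  apply: leq_trans IHk; rewrite addnS -addSn leq_add2r ltn_neqAle.
  by rewrite (introN idP (noP k)) exprS mxrankM_maxr.
by have := rk n.+1; rewrite leqNgt leq_addl.
Qed.

Definition mxindex M : nat := ex_minn (mxindex_ex M).

Definition is_drazin M D : bool :=
  let p := mxindex M in
  [&& M ^+ p.+1 *m D == M ^+ p, D *m M *m D == D & D *m M == M *m D].

Lemma is_drazin_ex M : exists D, is_drazin M D.
Proof.
rewrite /is_drazin; set p := mxindex M.
have rkp : \rank (M ^+ p.+1) = \rank (M ^+ p).
  by rewrite /p /mxindex; case: ex_minnP => q /eqP.
have [Z0 Z0E] : exists Z, M ^+ p = Z * M ^+ p.+1.
  apply/submxP; rewrite -(geq_leqif (mxrank_leqif_sup _)) ?rkp //.
  by rewrite exprS submxMl.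
have [W0 W0E] : exists W, M ^+ p = M ^+ p.+1 * W.
  have [W WE] : exists W, (M ^+ p)^T = W *m (M ^+ p.+1)^T.
    apply/submxP; rewrite -(geq_leqif (mxrank_leqif_sup _)) ?mxrank_tr ?rkp //.
    by rewrite exprSr trmx_mul submxMl.
  by exists W^T; apply: trmx_inj; rewrite trmx_mul trmxK.
have [Z ZE] : exists Z, M ^+ p = Z * M ^+ (p + p.+1).
  suff H k : exists Z, M ^+ p = Z * M ^+ (p + k) by [].
  elim: k => [|k [Z ZE]]; first by exists 1; rewrite addn0 mul1r.
  exists (Z * Z0).
  by rewrite addnS -addSn exprD mulrA -(mulrA Z) -Z0E -mulrA -exprD.
have [W WE] : exists W, M ^+ p = M ^+ (p + p.+1) * W.
  suff H k : exists W, M ^+ p = M ^+ (p + k) * W by [].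
  elim: k => [|k [W WE]]; first by exists 1; rewrite addn0 mulr1.
  exists (W0 * W).
  by rewrite addnS -addnS addnC addSnnS exprD !mulrA -(mulrA _ _ W0) -W0E -exprD
             addnC -WE.
have [] := @drazin_ring_ex _ p M Z W (pinvmx (M ^+ (p + p.+1))) ZE WE.
  by apply: mulmxKpV.
set D := M ^+ p * _ * _ => D1 D2 D3.
by exists D; apply/and3P; split; apply/eqP.
Qed.

Lemma is_drazin_uniq M D E : is_drazin M D -> is_drazin M E -> D = E.
Proof.
by move=> /and3P[/eqP ? /eqP ? /eqP ?] /and3P[/eqP ? /eqP ? /eqP ?];
  apply: (@drazin_ring_uniq _ (mxindex M) M).
Qed.

Definition drazinmx M : 'M[F]_n := xchoose (is_drazin_ex M).

Lemma drazinmxP M : is_drazin M (drazinmx M).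
Proof. exact: xchooseP. Qed.

End Drazin.

Section MoorePenrose.
Context {C : numClosedFieldType} {m n : nat}.
Implicit Types (M : 'M[C]_(m, n)) (P Q : 'M[C]_(n, m)).

Definition is_moore_penrose M P : bool :=
  [&& M *m P *m M == M, P *m M *m P == P,
      (M *m P)^t* == M *m P & (P *m M)^t* == P *m M].

Lemma gram_unitmx k l (G : 'M[C]_(k, l)) : row_free G -> G *m G^t* \in unitmx.
Proof.
move=> fG; rewrite -row_free_unit; apply: inj_row_free => v vGG.
apply: (row_free_inj fG); rewrite mul0mx; apply/eqP.
rewrite -(dnorm_eq0 (@dotmx C l)) /= dotmxE trmx_mul map_mxM.
by rewrite -mulmxA (mulmxA G) mulmxA vGG mul0mx mxE.
Qed.

Lemma is_moore_penrose_ex M : exists P, is_moore_penrose M P.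
Proof.
have [r [F [G [FG fF fG]]]] : exists r (F : 'M[C]_(m, r)) (G : 'M_(r, n)),
    [/\ F *m G = M, row_full F & row_free G].
  exists (\rank M), (col_base M), (row_base M).
  by rewrite mulmx_base col_base_full row_base_free.
have uG : G *m G^t* \in unitmx by apply: gram_unitmx.
have uF : F^t* *m F \in unitmx.
  rewrite -{2}[F]trmxCK; apply: gram_unitmx.
  by rewrite /row_free mxrank_map mxrank_tr.
pose Gi := G^t* *m invmx (G *m G^t* ); pose Fi := invmx (F^t* *m F) *m F^t*.
have GGi : G *m Gi = 1%:M by rewrite mulmxA mulmxV.
have FiF : Fi *m F = 1%:M by rewrite -mulmxA mulVmx.
have herm k (H : 'M[C]_k) : H^t* = H -> (invmx H)^t* = invmx H.
  by move=> HH; rewrite trmx_inv map_invmx HH.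
have MP : M *m (Gi *m Fi) = F *m Fi.
  by rewrite -FG -mulmxA (mulmxA G) GGi mul1mx.
have PM : Gi *m Fi *m M = Gi *m G.
  by rewrite -FG -mulmxA (mulmxA Fi) FiF mul1mx.
exists (Gi *m Fi); apply/and4P; split; apply/eqP; rewrite ?MP ?PM.
- by rewrite -FG -mulmxA (mulmxA Fi) FiF mul1mx.
- by rewrite mulmxA -(mulmxA Gi) GGi mulmx1.
- rewrite /Fi !trmx_mul !map_mxM trmxCK herm ?mulmxA //.
  by rewrite trmx_mul map_mxM trmxCK.
- rewrite /Gi !trmx_mul !map_mxM trmxCK herm ?mulmxA //.
  by rewrite trmx_mul map_mxM trmxCK.
Qed.

Lemma is_moore_penrose_uniq M P Q :
  is_moore_penrose M P -> is_moore_penrose M Q -> P = Q.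
Proof.
move=> /and4P[/eqP P1 /eqP P2 /eqP P3 /eqP P4].
move=> /and4P[/eqP Q1 /eqP Q2 /eqP Q3 /eqP Q4].
have MPQ : M *m P = M *m Q.
  by rewrite -P3 -{1}Q1 -mulmxA trmx_mul map_mxM P3 Q3 mulmxA P1.
have PQM : P *m M = Q *m M.
  by rewrite -P4 -{1}Q1 -mulmxA mulmxA trmx_mul map_mxM Q4 P4 -mulmxA
             (mulmxA M) P1.
by rewrite -P2 PQM -mulmxA MPQ mulmxA Q2.
Qed.

Definition mpinvmx M : 'M[C]_(n, m) := xchoose (is_moore_penrose_ex M).

Lemma mpinvmxP M : is_moore_penrose M (mpinvmx M).
Proof. exact: xchooseP. Qed.

End MoorePenrose.

(* The dimension of an affine set is that of its direction, which determines it
   uniquely; in particular the empty set has no dimension here. *)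
Definition has_affine_dim {K : fieldType} {V : vectType K} (S : set V)
    (d : nat) : Prop :=
  exists (x0 : V) (U : {vspace V}),
    S = [set x | x - x0 \in U]%classic /\ \dim U = d.

Section Equations.
Context {F : fieldType} {n : nat}.
Implicit Types A B C M : 'M[F]_n.

Definition stein_solutions A B C : set 'M[F]_n :=
  [set X | A *m X *m B - X = C]%classic.

Definition linear_solutions M C : set 'M[F]_n := [set X | M *m X = C]%classic.

Definition consistent (S : set 'M[F]_n) : Prop := exists X, S X.

Definition induced_vectors A B (a b : 'rV[F]_n) : Prop :=
  exists S, [/\ S \in unitmx, invmx S *m A *m S = diag_mx a
              & invmx S *m B *m S = diag_mx b].

End Equations.

(* Main.v *)
Require Import Defs.
From HB Require Import structures.
From mathcomp Require Import all_boot all_order all_algebra.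
From mathcomp Require Import spectral sesquilinear mxred complex.
From mathcomp Require Import boolp classical_sets cardinality reals.

Set Implicit Arguments.
Unset Strict Implicit.
Unset Printing Implicit Defensive.

Import Order.TTheory GRing.Theory Num.Theory.
Local Open Scope ring_scope.
Local Open Scope sesquilinear_scope.

(** In a common eigenbasis of A, B and C the Stein operator multiplies the
    (r, s) entry by a_r b_s - 1 and C is diagonal, so that an off-diagonal entry
    of a solution is 0 or free: its diagonal part is again a solution, and it
    solves (AB - I) X = C. As AB - I is diagonalizable, its Drazin inverse is its
    group inverse, whence Xhat is a solution as soon as there is one. *)

(** * Common eigenbases of commuting families, and the commutant of a diagonalizable matrix *)

Section SimultaneousDiagonalization.
Context {F : fieldType} {n : nat}.
Implicit Types (A B C D K M P X : 'M[F]_n) (a b c d : 'rV[F]_n).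

Lemma mulmx_conj P A B : P \in unitmx ->
  (invmx P *m A *m P) *m (invmx P *m B *m P) = invmx P *m (A *m B) *m P.
Proof. by move=> uP; rewrite -!mulmxA (mulmxA P (invmx P)) mulmxV // mul1mx. Qed.

Lemma diagonalizable_conj P d :
  P \in unitmx -> diagonalizable (invmx P *m diag_mx d *m P).
Proof.
move=> uP; exists P => //; apply/similar_diagPex; exists d.
by apply/similarP; rewrite // !mulmxA mulmxV // mul1mx.
Qed.

Lemma codiagonalizable_conj P (As : seq 'M[F]_n) :
    P \in unitmx -> all [pred A | similar_diag P A] As ->
  {in As, forall A, exists d, A = invmx P *m diag_mx d *m P}.
Proof.
move=> uP /allP sAs A /sAs /similar_diagPex[d /(similarLR uP) ->].
by exists d; rewrite conjVmx.
Qed.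

Lemma commuting_diagonalizable2 A B :
    comm_mx A B -> diagonalizable A -> diagonalizable B ->
  exists P a b, [/\ P \in unitmx, A = invmx P *m diag_mx a *m P
                  & B = invmx P *m diag_mx b *m P].
Proof.
move=> cAB dA dB; have [|P uP sP] := (codiagonalizableP [:: A; B]).1.
  split=> [f g|f]; rewrite !inE.
    by move=> /orP[]/eqP-> /orP[]/eqP->; rewrite /comm_mx ?cAB.
  by move=> /orP[]/eqP->.
have [a ->] := codiagonalizable_conj uP sP (mem_head _ _).
have [|b ->] := codiagonalizable_conj uP sP (_ : B \in _).
  by rewrite !inE eqxx orbT.
by exists P, a, b.
Qed.

Lemma commuting_diagonalizable3 A B C :
    comm_mx A B -> comm_mx A C -> comm_mx B C ->
    diagonalizable A -> diagonalizable B -> diagonalizable C ->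
  exists P a b c, [/\ P \in unitmx, A = invmx P *m diag_mx a *m P,
    B = invmx P *m diag_mx b *m P & C = invmx P *m diag_mx c *m P].
Proof.
move=> cAB cAC cBC dA dB dC.
have [|P uP sP] := (codiagonalizableP [:: A; B; C]).1.
  split=> [f g|f]; rewrite !inE.
    by move=> /or3P[]/eqP-> /or3P[]/eqP->; rewrite /comm_mx ?cAB ?cAC ?cBC.
  by move=> /or3P[]/eqP->.
have [a ->] := codiagonalizable_conj uP sP (mem_head _ _).
have [|b ->] := codiagonalizable_conj uP sP (_ : B \in _).
  by rewrite !inE eqxx orbT.
have [|c ->] := codiagonalizable_conj uP sP (_ : C \in _).
  by rewrite !inE eqxx !orbT.
by exists P, a, b, c.
Qed.

Lemma diagonalizableD A B : comm_mx A B ->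
  diagonalizable A -> diagonalizable B -> diagonalizable (A + B).
Proof.
move=> cAB dA dB.
have [P [a [b [uP -> ->]]]] := commuting_diagonalizable2 cAB dA dB.
by rewrite -mulmxDl -mulmxDr -raddfD; apply: diagonalizable_conj.
Qed.

Lemma diagonalizableM A B : comm_mx A B ->
  diagonalizable A -> diagonalizable B -> diagonalizable (A *m B).
Proof.
move=> cAB dA dB.
have [P [a [b [uP -> ->]]]] := commuting_diagonalizable2 cAB dA dB.
by rewrite mulmx_conj // mulmx_diag; apply: diagonalizable_conj.
Qed.

(* Applying f to the eigenvalues of M amounts to evaluating an interpolation
   polynomial of f at M, hence preserves the commutant. *)
Lemma comm_mx_conj_map P d (f : F -> F) K : P \in unitmx ->
    comm_mx (invmx P *m diag_mx d *m P) K ->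
  comm_mx (invmx P *m diag_mx (map_mx f d) *m P) K.
Proof.
move=> uP; have [K' ->] : exists K', K = invmx P *m K' *m P.
  by exists (P *m K *m invmx P); rewrite !mulmxA mulVmx // mul1mx mulmxKV.
rewrite /comm_mx !mulmx_conj // => dK.
have {}dK : diag_mx d *m K' = K' *m diag_mx d.
  apply: (can_inj (mulKVmx uP)); apply: (can_inj (mulmxK uP)); exact: dK.
congr (_ *m _ *m _); apply/matrixP => i j.
move/matrixP/(_ i j): dK; rewrite !mul_diag_mx !mul_mx_diag !mxE mulrC.
(* A nonzero entry (i, j) of [K'] forces d_i = d_j, hence f(d_i) = f(d_j). *)
have [-> _|nz] := eqVneq (K' i j) 0; first by rewrite mulr0 mul0r.
by move/(mulfI nz) => ->; rewrite mulrC.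
Qed.

End SimultaneousDiagonalization.

(** * Drazin inverses computed on eigenvalues *)

Section DrazinDiagonalizable.
Context {F : fieldType} {n : nat}.
Implicit Types (D K M P : 'M[F]_n) (d : 'rV[F]_n).

(** The hypotheses make [D] the group inverse of [M], and the index need not be computed. If it is
    0, then [M] is invertible and M D M = M gives M D = 1; if it is p + 1, a factor [M] split off
    M^(p+1) absorbs D M. *)
Lemma drazinmx_group M D :
  M *m D *m M = M -> D *m M *m D = D -> D *m M = M *m D -> drazinmx M = D.
Proof.
move=> MDM DMD DM; apply: is_drazin_uniq (drazinmxP M) _.
rewrite /is_drazin DMD DM !eqxx !andbT; apply/eqP.
have : \rank (M ^+ (mxindex M).+1) = \rank (M ^+ mxindex M).
  by rewrite /mxindex; case: ex_minnP => q /eqP.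
case: (mxindex M) => [|p] rkM.
  have uM : M \in unitmx.
    by move: rkM; rewrite expr1 expr0 mxrank1 -row_full_unit => /eqP.
  by rewrite expr1 expr0; apply: (can_inj (mulmxK uM)); rewrite MDM mul1mx.
have XS k : M ^+ k.+1 = M ^+ k *m M by rewrite exprSr.
by rewrite (XS p.+1) -mulmxA -DM (XS p) -mulmxA (mulmxA M) MDM.
Qed.

(** Since the inverse of 0 is 0 by convention, [GRing.inv] fixes the zero eigenvalues and inverts
    the others, which is the group inverse of a diagonal matrix. *)
Lemma drazinmx_conj P d : P \in unitmx ->
  drazinmx (invmx P *m diag_mx d *m P) =
  invmx P *m diag_mx (map_mx GRing.inv d) *m P.
Proof.
move=> uP; apply: drazinmx_group; rewrite !mulmx_conj // !mulmx_diag.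
- congr (_ *m diag_mx _ *m _); apply/rowP => i; rewrite !mxE.
  by have [->|?] := eqVneq (d 0 i) 0; rewrite ?mulr0 // mulfVK.
- congr (_ *m diag_mx _ *m _); apply/rowP => i; rewrite !mxE.
  by have [->|?] := eqVneq (d 0 i) 0; rewrite ?invr0 ?mulr0 // mulVf // mul1r.
- congr (_ *m diag_mx _ *m _); apply/rowP => i; rewrite !mxE; exact: mulrC.
Qed.

Lemma drazinmx_comm M K :
  diagonalizable M -> comm_mx M K -> comm_mx (drazinmx M) K.
Proof.
(* Pairing [M] with itself yields an eigenbasis of the single matrix [M]. *)
move=> dM; have [P [d [_ [uP -> _]]]] :=
  commuting_diagonalizable2 (comm_mx_refl M) dM dM.
by rewrite drazinmx_conj //; apply: comm_mx_conj_map.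
Qed.

Lemma diagonalizable_drazinmx M : diagonalizable M -> diagonalizable (drazinmx M).
Proof.
move=> dM; have [P [d [_ [uP -> _]]]] :=
  commuting_diagonalizable2 (comm_mx_refl M) dM dM.
by rewrite drazinmx_conj //; apply: diagonalizable_conj.
Qed.

(** A diagonalizable matrix has index at most 1, so its Drazin inverse is also an inner inverse. *)
Lemma mulmx_drazinmxK M : diagonalizable M -> M *m drazinmx M *m M = M.
Proof.
move=> dM; have [P [d [_ [uP -> _]]]] :=
  commuting_diagonalizable2 (comm_mx_refl M) dM dM.
rewrite drazinmx_conj // !mulmx_conj // !mulmx_diag.
congr (_ *m diag_mx _ *m _); apply/rowP => i; rewrite !mxE.
by have [->|?] := eqVneq (d 0 i) 0; rewrite ?mulr0 // mulfVK.
Qed.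

Lemma drazinmx_unit M : M \in unitmx -> drazinmx M = invmx M.
Proof.
move=> uM; apply: drazinmx_group; first by rewrite mulmxV // mul1mx.
  by rewrite mulVmx // mul1mx.
by rewrite mulmxV // mulVmx.
Qed.

End DrazinDiagonalizable.

(** * Normal matrices through unitary diagonalization *)

Section Normal.
Context {K : numClosedFieldType} {n : nat}.
Implicit Types (A B M P : 'M[K]_n) (d : 'rV[K]_n).

Lemma adjmxM A B : (A *m B)^t* = B^t* *m A^t*.
Proof. by rewrite trmx_mul map_mxM. Qed.

Lemma adjmx_conj P d : P \is unitarymx ->
  (invmx P *m diag_mx d *m P)^t* = invmx P *m diag_mx (map_mx Num.conj d) *m P.
Proof.
move=> uP; rewrite !invmx_unitary // !adjmxM trmxCK.
by rewrite tr_diag_mx map_diag_mx mulmxA.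
Qed.

Lemma normal_conj A : A \is normalmx ->
  exists P d, P \is unitarymx /\ A = invmx P *m diag_mx d *m P.
Proof.
move=> /orthomx_spectralP eA; exists (spectralmx A), (spectral_diag A).
by split; first exact: spectral_unitarymx.
Qed.

(* Fuglede's theorem in finite dimension. *)
Lemma normal_adj_comm A B : A \is normalmx -> comm_mx A B -> comm_mx (A^t* ) B.
Proof.
move=> /normal_conj[P [d [uP ->]]]; rewrite adjmx_conj //.
exact/comm_mx_conj_map/unitarymx_unit.
Qed.

(** By Fuglede, each factor commutes with the adjoint of the other, so the four factors can be
    reordered using the normality of [A] and of [B]. *)
Lemma normalmxM A B : A \is normalmx -> B \is normalmx -> comm_mx A B ->
  A *m B \is normalmx.
Proof.
move=> nA nB cAB; apply/normalmxP; rewrite adjmxM.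
have cA'B := normal_adj_comm nA cAB.
have cB'A : comm_mx (B^t* ) A by apply: normal_adj_comm nB (comm_mx_sym cAB).
have [eA eB] := (normalmxP nA, normalmxP nB).
rewrite mulmxA -(mulmxA A) eB mulmxA -cB'A -!mulmxA; congr (_ *m _).
by rewrite -cA'B !mulmxA eA.
Qed.

Lemma normalmxB1 A : A \is normalmx -> A - 1%:M \is normalmx.
Proof.
move=> /normal_conj[P [d [uP ->]]]; apply/orthomx_spectral_subproof.
exists (P, d - const_mx 1) => //=; rewrite raddfB /= diag_const_mx.
by rewrite mulmxBr mulmxBl mulmx1 mulVmx ?unitarymx_unit.
Qed.

Lemma normal_drazinmx A : A \is normalmx -> drazinmx A \is normalmx.
Proof.
move=> /normal_conj[P [d [uP ->]]]; rewrite drazinmx_conj ?unitarymx_unit //.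
by apply/orthomx_spectral_subproof; exists (P, map_mx GRing.inv d).
Qed.

(** In a unitary eigenbasis the products of [A] with its Drazin inverse are diagonal with entries 0
    or 1, hence Hermitian, so the four Penrose equations hold. *)
Lemma mpinvmx_normal A : A \is normalmx -> mpinvmx A = drazinmx A.
Proof.
move=> /normal_conj[P [d [uP ->]]]; have uP' := unitarymx_unit uP.
apply: is_moore_penrose_uniq (mpinvmxP _) _; rewrite drazinmx_conj //.
rewrite /is_moore_penrose !mulmx_conj // !mulmx_diag !adjmx_conj //.
apply/and4P; split; apply/eqP; congr (_ *m diag_mx _ *m _);
  apply/rowP => i; rewrite !mxE; have [->|nz] := eqVneq (d 0 i) 0;
  by rewrite ?mulr0 ?mul0r ?invr0 ?conjC0 ?mulfV ?mulVf ?mul1r ?conjC1 ?invr0 ?mulr0.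
Qed.

End Normal.

(** * The Stein operator: its matrix entries, its kernel, and the shape of the solution set *)

Section Stein.
Context {F : fieldType} {n : nat}.
Implicit Types (A B C S X Z : 'M[F]_n) (a b : 'rV[F]_n).

Lemma stein_comm A B X : comm_mx X B ->
  A *m X *m B - X = (A *m B - 1%:M) *m X.
Proof. by move=> cXB; rewrite mulmxBl mul1mx -!mulmxA cXB. Qed.

(* Only the diagonal entries of the equation matter in a common eigenbasis of
   A, B and C, so dropping the other entries of a solution gives one commuting
   with A and B. *)
Lemma stein_linear A B C :
    comm_mx A B -> comm_mx A C -> comm_mx B C ->
    diagonalizable A -> diagonalizable B -> diagonalizable C ->
    consistent (stein_solutions A B C) ->
  consistent (linear_solutions (A *m B - 1%:M) C).
Proof.
move=> cAB cAC cBC dA dB dC [X]; rewrite /stein_solutions /=.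
have [P [a [b [c [uP -> -> ->]]]]] :=
  commuting_diagonalizable3 cAB cAC cBC dA dB dC.
have [Y ->] : exists Y, X = invmx P *m Y *m P.
  by exists (P *m X *m invmx P); rewrite !mulmxA mulVmx // mul1mx mulmxKV.
rewrite !mulmx_conj // -mulmxBl -mulmxBr => eX.
have {}eX : diag_mx a *m Y *m diag_mx b - Y = diag_mx c.
  apply: (can_inj (mulKVmx uP)); apply: (can_inj (mulmxK uP)); exact: eX.
pose y := \row_i Y i i; exists (invmx P *m diag_mx y *m P).
rewrite /linear_solutions /= mulmxBl mul1mx !mulmx_conj // -mulmxBl -mulmxBr.
congr (_ *m _ *m _); rewrite !mulmx_diag -raddfB; congr diag_mx.
apply/rowP => i; move/matrixP/(_ i i): eX.
by rewrite mul_mx_diag mul_diag_mx !mxE eqxx !mulr1n => <-; rewrite mulrAC.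
Qed.

(** In the basis given by [S] the homogeneous equation decouples into one scalar condition per
    entry, a_r y_rs b_s = y_rs. *)
Lemma stein_entries A B S a b : S \in unitmx ->
    invmx S *m A *m S = diag_mx a -> invmx S *m B *m S = diag_mx b ->
  forall Z, A *m Z *m B = Z <->
    forall r s, (invmx S *m Z *m S) r s != 0 -> a 0 r * b 0 s = 1.
Proof.
move=> uS eA eB Z; set Y := invmx S *m Z *m S.
have -> : A *m Z *m B = Z <-> diag_mx a *m Y *m diag_mx b = Y.
  rewrite -eA -eB !mulmx_conj //; split=> [-> //|].
  by move/(can_inj (mulmxK uS))/(can_inj (mulKVmx uS)).
clearbody Y; split=> [eY r s nz|eY].
  move/matrixP/(_ r s): eY; rewrite mul_mx_diag mul_diag_mx !mxE mulrAC.
  by move=> eY; apply: (mulIf nz); rewrite mul1r.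
apply/matrixP => r s; rewrite mul_mx_diag mul_diag_mx !mxE mulrAC.
have [->|/eY ->] := eqVneq (Y r s) 0; first by rewrite mulr0.
by rewrite mul1r.
Qed.

(** The matrix units E_rs with a_r b_s = 1, conjugated back by [S], form a basis of the kernel of
    the homogeneous operator Z -> A Z B - Z. *)
Lemma stein_kernel_dim A B a b : induced_vectors A B a b ->
  \dim (lker (linfun (mulmxr B \o mulmx A \- idfun))) =
  #|[set rs : 'I_n * 'I_n | a 0 rs.1 * b 0 rs.2 == 1]|.
Proof.
move=> [S [uS eA eB]]; set T := [set rs | _]; set U := lker _.
have UP Z : (Z \in U) = (A *m Z *m B == Z).
  by rewrite memv_ker lfunE /= subr_eq0.
have stP := stein_entries uS eA eB.
pose f (rs : 'I_n * 'I_n) := S *m delta_mx rs.1 rs.2 *m invmx S.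
pose X := [tuple f (enum_val i) | i < #|T|].
have conjK (V : 'M[F]_n) : invmx S *m (S *m V *m invmx S) *m S = V.
  by rewrite !mulmxA mulVmx // mul1mx mulmxKV.
have XU : {subset X <= U}.
  move=> _ /mapP[i _ ->]; rewrite UP; apply/eqP/stP => r s.
  rewrite conjK mxE; have := enum_valP i; rewrite inE => /eqP.
  by case: andP => [[/eqP-> /eqP->]|_ _]; rewrite ?eqxx.
have UX : (U <= <<X>>)%VS.
  apply/subvP => Z; rewrite UP => /eqP/stP.
  set Y := invmx S *m Z *m S => YT.
  have -> : Z = \sum_r \sum_s Y r s *: f (r, s).
    transitivity (S *m Y *m invmx S).
      by rewrite !mulmxA mulmxV // mul1mx mulmxK.
    rewrite [in LHS](matrix_sum_delta Y) mulmx_sumr mulmx_suml.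
    apply: eq_bigr => r _; rewrite mulmx_sumr mulmx_suml.
    by apply: eq_bigr => s _; rewrite -scalemxAr -scalemxAl.
  apply: memv_suml => r _; apply: memv_suml => s _.
  have [->|/YT/eqP rsT] := eqVneq (Y r s) 0; first by rewrite scale0r mem0v.
  apply: memvZ; apply: memv_span; have rT : (r, s) \in T by rewrite inE.
  by apply/mapP; exists (enum_rank_in rT (r, s)); rewrite ?mem_enum ?enum_rankK_in.
(* After conjugation by [S], a vanishing combination of these vectors is one of distinct matrix
   units, and its entry at [enum_val i] is the coefficient [k i]. *)
have fX : free X.
  apply/freeP => k; under eq_bigr do rewrite nth_mktuple.
  move=> k0 i; have := congr1 (fun V => invmx S *m V *m S) k0.
  rewrite mulmx0 mul0mx mulmx_sumr mulmx_suml.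
  under eq_bigr do rewrite -scalemxAr -scalemxAl conjK.
  move/matrixP/(_ (enum_val i).1 (enum_val i).2); rewrite summxE (bigD1 i) //=.
  rewrite big1 => [|j ji]; rewrite !mxE ?eqxx ?mulr1 ?addr0 //.
  rewrite -[_ && _]/(enum_val i == enum_val j) (inj_eq enum_val_inj).
  by rewrite eq_sym (negPf ji) mulr0.
apply: (@size_basis _ _ U _ X); rewrite /basis_of eqEsubv UX fX !andbT.
by apply/span_subvP.
Qed.

Lemma stein_subr A B C X X0 :
    stein_solutions A B C X -> stein_solutions A B C X0 ->
  A *m (X - X0) *m B = X - X0.
Proof.
rewrite /stein_solutions /= => /eqP; rewrite subr_eq => /eqP eX /eqP.
by rewrite subr_eq => /eqP eX0; rewrite mulmxBr mulmxBl eX eX0 opprD addrACA subrr add0r.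
Qed.

Lemma stein_affine A B C X0 : stein_solutions A B C X0 ->
  stein_solutions A B C =
  [set X | X - X0 \in lker (linfun (mulmxr B \o mulmx A \- idfun))]%classic.
Proof.
move=> eX0; apply/seteqP; split=> X /=; rewrite memv_ker lfunE /= subr_eq0.
  by move=> eX; rewrite (stein_subr eX eX0).
move: eX0; rewrite /stein_solutions /= => <-; rewrite mulmxBr mulmxBl subr_eq.
by move=> /eqP ->; rewrite addrC addrA addKr addrC.
Qed.

(** The solution set contains the points X0 + k Z, which are pairwise distinct because the
    injectivity hypothesis says that [F] has characteristic zero. *)
Lemma infinite_stein_solutions A B C X0 Z :
    injective (fun k : nat => k%:R : F) ->
    stein_solutions A B C X0 -> A *m Z *m B = Z -> Z != 0 ->
  infinite_set (stein_solutions A B C).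
Proof.
move=> natF_inj eX0 eZ nzZ; pose f k := X0 + k%:R *: Z.
have f_inj : injective f.
  move=> k l /addrI/eqP; rewrite -subr_eq0 -scalerBl scaler_eq0 (negPf nzZ).
  by rewrite orbF subr_eq0 => /eqP/natF_inj.
(* If the solutions were finitely many, so would be their preimage under the injection [f], which is
   all of [nat]. *)
move=> /(@finite_preimage _ _ _ f (in2W f_inj)); apply: contra_not infinite_nat.
apply: sub_finite_set => k _; rewrite /stein_solutions /f /=.
rewrite mulmxDr mulmxDl -scalemxAr -scalemxAl eZ opprD addrACA subrr addr0.
exact: eX0.
Qed.

End Stein.

(** * The matrix [Xhat] for a commuting diagonalizable triple, and its comparison with other
    solutions *)

Section SteinDrazin.
Context {F : fieldType} {n : nat}.
Context (A B C : 'M[F]_n).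
Context (cAB : comm_mx A B) (cAC : comm_mx A C) (cBC : comm_mx B C).
Context (dA : diagonalizable A) (dB : diagonalizable B).
Context (dC : diagonalizable C).
Let M := A *m B - 1%:M.
Let Xhat := drazinmx M *m C.

Let dM : diagonalizable M.
Proof.
apply: diagonalizableD.
- by rewrite -scaleN1r scalemx1; apply: comm_mx_scalar.
- exact: diagonalizableM.
- by rewrite -scaleN1r scalemx1; apply: diagonalizable_scalar.
Qed.

Let cM K : comm_mx A K -> comm_mx B K -> comm_mx M K.
Proof.
move=> cAK cBK; apply: comm_mx_sym; apply: comm_mxB; last exact: comm_mx1.
by apply: comm_mxM; apply: comm_mx_sym.
Qed.

Lemma comm_drazinmx_factor K : comm_mx A K -> comm_mx B K -> comm_mx (drazinmx M) K.
Proof. by move=> cAK cBK; apply: drazinmx_comm => //; apply: cM. Qed.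

Lemma comm_drazinmx_stein K :
  comm_mx A K -> comm_mx B K -> comm_mx C K -> comm_mx Xhat K.
Proof.
move=> cAK cBK cCK; apply/comm_mx_sym/comm_mxM; apply: comm_mx_sym => //.
exact: comm_drazinmx_factor.
Qed.

Let cXB : comm_mx Xhat B.
Proof. exact: comm_drazinmx_stein. Qed.

Lemma diagonalizable_drazinmx_stein : diagonalizable Xhat.
Proof.
apply: diagonalizableM => //; first exact: comm_drazinmx_factor.
exact: diagonalizable_drazinmx.
Qed.

(** If C = M X, then M Xhat = M D M X = M X = C, with D the Drazin inverse of [M]. *)
Lemma linear_drazinmx_stein :
  consistent (linear_solutions M C) -> linear_solutions M C Xhat.
Proof.
move=> [X]; rewrite /linear_solutions /= => eX.
by rewrite -eX /Xhat -[in LHS]eX !mulmxA mulmx_drazinmxK.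
Qed.

(** As [Xhat] commutes with [B], the two equations have the same left-hand side at [Xhat]. *)
Lemma stein_linear_drazinmx :
  stein_solutions A B C Xhat <-> linear_solutions M C Xhat.
Proof. by rewrite /stein_solutions /linear_solutions /= stein_comm. Qed.

Lemma stein_consistency :
  [/\ consistent (stein_solutions A B C) <-> stein_solutions A B C Xhat,
      consistent (stein_solutions A B C) <-> consistent (linear_solutions M C)
    & consistent (stein_solutions A B C) <-> linear_solutions M C Xhat].
Proof.
have EL : consistent (stein_solutions A B C) -> consistent (linear_solutions M C).
  exact: stein_linear.
have LX := linear_drazinmx_stein; have XE := stein_linear_drazinmx.
have XC : stein_solutions A B C Xhat -> consistent (stein_solutions A B C).
  by exists Xhat.
by split; split; tauto.
Qed.

(* The difference Z of X and Xhat is diagonal in the basis inducing (a, b),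
   hence commutes with A and B and satisfies M *m Z = 0: Z and Xhat annihilate
   each other, and X = Xhat + Z is a sum of commuting diagonalizable matrices. *)
Lemma diagonalizable_stein_solutions a b :
    consistent (stein_solutions A B C) -> induced_vectors A B a b ->
    (forall r s, r != s -> a 0 r * b 0 s != 1) ->
  forall X, stein_solutions A B C X -> diagonalizable X.
Proof.
case: stein_consistency => cE _ _ /cE eXhat [S [uS eA eB]] ab X eX.
have eZ := stein_subr eX eXhat; set Z := X - Xhat in eZ.
(* The double inverse gives [Z] the shape expected by the conjugation lemmas, with [invmx S] in the
   role of [P]. *)
have [z Zz] : exists z, Z = invmx (invmx S) *m diag_mx z *m invmx S.
  have /diag_mxP[z Sz] : is_diag_mx (invmx S *m Z *m S).
    apply/is_diag_mxP => r s rs; apply: contraTeq (ab r s rs) => nz.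
    by rewrite negbK; apply/eqP/(stein_entries uS eA eB Z).1.
  by exists z; rewrite -Sz invmxK !mulmxA mulmxV // mul1mx mulmxK.
have comm_Z V v : invmx S *m V *m S = diag_mx v -> comm_mx V Z.
  move=> eV; have -> : V = invmx (invmx S) *m diag_mx v *m invmx S.
    by rewrite -eV invmxK !mulmxA mulmxV // mul1mx mulmxK.
  by rewrite Zz /comm_mx !mulmx_conj ?unitmx_inv // diag_mxC.
have [cAZ cBZ] := (comm_Z A a eA, comm_Z B b eB).
have cDZ : comm_mx (drazinmx M) Z by apply: comm_drazinmx_factor.
have MZ : M *m Z = 0 by rewrite -stein_comm ?eZ ?subrr.
have DZ : drazinmx M *m Z = 0.
  have /and3P[_ /eqP <- _] := drazinmxP M.
  by rewrite -!mulmxA cDZ (mulmxA M) MZ mul0mx mulmx0.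
have XZ : Xhat *m Z = 0 by rewrite /Xhat comm_drazinmx_factor // -mulmxA DZ mulmx0.
have ZX : Z *m Xhat = 0 by rewrite /Xhat mulmxA -cDZ DZ mul0mx.
rewrite -(subrK Xhat X); apply: diagonalizableD.
- by rewrite /comm_mx ZX XZ.
- by rewrite -/Z Zz; apply: diagonalizable_conj; rewrite unitmx_inv.
- exact: diagonalizable_drazinmx_stein.
Qed.

(** A solution commuting with [B] satisfies M X = C, one commuting with [A] satisfies X M = C;
    cancelling the invertible [M] leaves only [Xhat] in both cases. *)
Lemma stein_noncommuting X : M \in unitmx ->
    stein_solutions A B C X -> X <> Xhat ->
  A *m X <> X *m A /\ B *m X <> X *m B.
Proof.
move=> uM eX nX; have cXB_sol V : stein_solutions A B C V -> comm_mx V B -> V = Xhat.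
  rewrite /stein_solutions /Xhat /= => <- cVB.
  by rewrite stein_comm // drazinmx_unit // mulKmx.
split=> cX; apply: nX; last exact: cXB_sol.
have XM : X *m M = C by rewrite -eX mulmxBr mulmx1 mulmxA cX.
have DC : Xhat = C *m drazinmx M.
  by rewrite /Xhat comm_drazinmx_factor //; apply: comm_mx_sym.
by rewrite DC -XM drazinmx_unit // mulmxK.
Qed.

Lemma infinite_stein_noninvertible :
    injective (fun k : nat => k%:R : F) ->
    consistent (stein_solutions A B C) -> M \notin unitmx ->
  infinite_set (stein_solutions A B C).
Proof.
(* [Z] is the spectral projector of [M] at the eigenvalue 0. It commutes with [B], so M Z = 0 makes
   it a homogeneous solution. *)
move=> natF_inj [X0 eX0] nuM; pose Z := 1%:M - drazinmx M *m M.
have MZ : M *m Z = 0.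
  by rewrite mulmxBr mulmx1 mulmxA mulmx_drazinmxK ?subrr.
apply: infinite_stein_solutions natF_inj eX0 (_ : A *m Z *m B = Z) _.
  apply/eqP; rewrite -subr_eq0 stein_comm ?MZ //.
  apply: comm_mx_sym; apply: comm_mxB; first exact: comm_mx1.
  by apply: comm_mxM; apply: comm_mx_sym; [apply: comm_drazinmx_factor|apply: cM].
(* Z = 0 would make the Drazin inverse a left inverse of [M]. *)
apply: contraNneq nuM => /eqP; rewrite subr_eq0 eq_sym => /eqP.
by case/mulmx1_unit.
Qed.

End SteinDrazin.

(* Stated for a variable X because, instantiated at R[i], unification blows up
   when the term tested for normality is a matrix product. *)
Lemma normal_drazinmx_stein (K : numClosedFieldType) (n : nat)
    (A B C X : 'M[K]_n) :
    comm_mx A B -> comm_mx A C -> comm_mx B C ->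
    diagonalizable A -> diagonalizable B ->
    A \is normalmx -> B \is normalmx -> C \is normalmx ->
    X = drazinmx (A *m B - 1%:M) *m C ->
  X = mpinvmx (A *m B - 1%:M) *m C /\ X \is normalmx.
Proof.
move=> cAB cAC cBC dA dB nA nB nC ->; set M := A *m B - 1%:M.
have nM : M \is normalmx by apply: normalmxB1; apply: normalmxM.
split; first by rewrite mpinvmx_normal.
apply: normalmxM => //; first exact: normal_drazinmx.
exact: comm_drazinmx_factor.
Qed.

Theorem theorem4p1 (R : realType) (n : nat) (A B C : 'M[R[i]]_n)
    (cAB : comm_mx A B) (cAC : comm_mx A C) (cBC : comm_mx B C)
    (dA : diagonalizable A) (dB : diagonalizable B) (dC : diagonalizable C) :
  let M := A *m B - 1%:M in
  let Xhat := drazinmx M *m C in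
  let E := stein_solutions A B C in
  let L := linear_solutions M C in
  (* (i) *)
  ([/\ diagonalizable Xhat, comm_mx Xhat A, comm_mx Xhat B & comm_mx Xhat C] /\
   (A \is normalmx -> B \is normalmx -> C \is normalmx ->
      Xhat = mpinvmx M *m C /\ Xhat \is normalmx)) /\
  (* (ii) *)
  [/\ consistent E <-> E Xhat,
      consistent E <-> consistent L
    & consistent E <-> L Xhat] /\
  (* (iii) *)
  (forall a b : 'rV[R[i]]_n, consistent E -> induced_vectors A B a b ->
     has_affine_dim E
       #|[set rs : 'I_n * 'I_n | a 0 rs.1 * b 0 rs.2 == 1]%SET| /\
     ((forall r s : 'I_n, r != s -> a 0 r * b 0 s != 1) ->
        forall X, E X -> diagonalizable X)) /\
  (* (iv) *)
  (M \in unitmx ->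
     Xhat = invmx M *m C /\
     (forall X, E X -> X <> Xhat ->
        A *m X <> X *m A /\ B *m X <> X *m B)) /\
  (* (v) *)
  (consistent E -> M \notin unitmx -> infinite_set E).
Proof.
move=> M Xhat E L; split; last split; last split; last split.
- split.
    split; first exact: diagonalizable_drazinmx_stein.
    + by apply: comm_drazinmx_stein => //; apply: comm_mx_sym.
    + by apply: comm_drazinmx_stein => //; apply: comm_mx_sym.
    + exact: comm_drazinmx_stein.
  move=> nA nB nC; have [X eX] : exists X, X = Xhat by exists Xhat.
  rewrite -eX.
  have XP := @normal_drazinmx_stein R[i] n A B C X cAB cAC cBC dA dB nA nB nC eX.
  exact: XP.
- exact: stein_consistency.
- move=> a b cE ab; split; last exact: diagonalizable_stein_solutions.
  have [X0 eX0] := cE; exists X0, (lker (linfun (mulmxr B \o mulmx A \- idfun))).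
  by split; [exact: stein_affine | exact: stein_kernel_dim].
- move=> uM; split=> [|X]; last exact: stein_noncommuting.
  by rewrite /Xhat drazinmx_unit.
(* What remains is that [R[i]] has characteristic zero. *)
- apply: infinite_stein_noninvertible => // k l /eqP.
  by rewrite eqr_nat => /eqP.
Qed.
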